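(* Let $X$ be a metrizable Suslin space, $Y$ a separable Fréchet space, $\alpha$ a successor countable ordinal, and $f:X\to Y$ a function. Then $f$ is Baire-$\alpha$ if and only if there is a sequence $(G_n)_{n=1}^{\infty}$ of $\Sigma_\alpha$-strips in $X\times Y$ with $G_{n+1}\subseteq G_n$ for all $n$, such that (i) $\bigcap_{n=1}^{\infty}G_n=gr(f)$; (ii) $diam(G_n(x))\to 0$ as $n\to\infty$ for each $x\in X$; (iii) for each $n$ and each open subset $U\subseteq Y$, the projection of $(X\times U)\cap G_n$ to $X$ is in $\Sigma_\alpha$.
   Context: A Suslin space is a Hausdorff topological space that is a continuous image of a Polish space; $X$ is additionally assumed metrizable (with a fixed metric). A Fréchet space is a locally convex topological vector space that is complete with respect to a translation invariant metric; diameters in $Y$ are with respect to this metric. Borel classes: $\Sigma_1$ = open sets; for countable $\alpha\ge1$, $\Pi_\alpha$ = complements of $\Sigma_\alpha$ sets; for $\alpha>1$, $\Sigma_\alpha$ = countable unions of sets $A_i\in\Pi_{\alpha_i}$ with $\alpha_i<\alpha$. Baire-0 functions are the continuous functions; for $\alpha\ge 1$, a function is Baire-$\alpha$ if it is a pointwise limit of functions $f_n$ that are Baire-$\alpha_n$ with $\alpha_n<\alpha$. $gr(f)=\{(x,f(x)):x\in X\}$. For $G\subseteq X\times Y$, $G(x)=\{y:(x,y)\in G\}$. A $\Sigma_\alpha$-strip is a $\Sigma_\alpha$ set $S\subseteq X\times Y$ with $S(x)$ convex for each $x\in X$. *)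

(* Defs.v *)
From HB Require Import structures.
From mathcomp Require Import all_boot all_order all_algebra.
From mathcomp Require Import all_classical all_reals all_analysis.
Set Implicit Arguments. Unset Strict Implicit. Unset Printing Implicit Defensive.
Import Order.TTheory GRing.Theory Num.Theory.
Import numFieldNormedType.Exports.
Local Open Scope classical_set_scope.
Local Open Scope ring_scope.

(** * Countable ordinals as Brouwer trees.
    [OZ] is 0, [OS a] is a+1, [OL f] is sup_n (f n).  Every countable ordinal is
    represented, and every tree denotes a countable ordinal. *)
Inductive cord : Type :=
| OZ : cord
| OS : cord -> cord
| OL : (nat -> cord) -> cord.

Inductive ole : cord -> cord -> Prop :=
| ole_Z b : ole OZ b
| ole_S a b : olt a b -> ole (OS a) b
| ole_L (f : nat -> cord) b : (forall n, ole (f n) b) -> ole (OL f) b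
with olt : cord -> cord -> Prop :=
| olt_S a b : ole a b -> olt a (OS b)
| olt_L a (f : nat -> cord) n : olt a (f n) -> olt a (OL f).

Definition oeq (a b : cord) : Prop := ole a b /\ ole b a.
Definition one : cord := OS OZ.

Definition successor_ord (a : cord) : Prop := exists b, oeq a (OS b).

Inductive Sigma_class (T : topologicalType) : cord -> set T -> Prop :=
| Sigma_open a (A : set T) : oeq a one -> open A -> Sigma_class a A
| Sigma_union a (A : set T) (ai : nat -> cord) (B : nat -> set T) :
    olt one a -> (forall i, olt (ai i) a) ->
    (forall i, Sigma_class (ai i) (~` B i)) ->
    A = \bigcup_i B i -> Sigma_class a A.

Definition Pi_class (T : topologicalType) (a : cord) (A : set T) : Prop :=
  Sigma_class a (~` A).

Inductive Baire_class (X Y : topologicalType) : cord -> (X -> Y) -> Prop :=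
| Baire_cont a (f : X -> Y) : oeq a OZ -> continuous f -> Baire_class a f
| Baire_lim a (f : X -> Y) (ai : nat -> cord) (fs : nat -> X -> Y) :
    ole one a -> (forall n, olt (ai n) a) ->
    (forall n, Baire_class (ai n) (fs n)) ->
    (forall x, (fun n => fs n x) @ \oo --> f x) -> Baire_class a f.

Definition separable_space (T : topologicalType) : Prop :=
  exists D : set T, countable D /\ dense D.

Definition suslin_space (R : realType) (X : topologicalType) : Prop :=
  hausdorff_space X /\
  exists P : completePseudoMetricType R,
    hausdorff_space P /\ separable_space P /\
    exists g : P -> X, continuous g /\ (forall x, exists p, g p = x).

Definition frechet_metric (R : realType) (Y : tvsType R) (d : Y -> Y -> R) : Prop :=
  (forall y z, d y z = 0 <-> y = z) /\
      (forall y z, d y z = d z y) /\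
      (forall y z w, d y w <= d y z + d z w) /\
      (forall y z w, d (y + w) (z + w) = d y z) /\
      (forall (y : Y) (A : set Y),
          nbhs y A <-> (exists2 e : R, 0 < e & [set z | d y z < e] `<=` A)) /\
      (forall u : nat -> Y,
          (forall e : R, 0 < e -> exists N, forall m n, (N <= m)%N -> (N <= n)%N ->
              d (u m) (u n) < e) ->
          exists l : Y, u @ \oo --> l).

Definition section (X Y : Type) (G : set (X * Y)) (x : X) : set Y :=
  [set y | G (x, y)].

Definition diam (R : realType) (Y : Type) (d : Y -> Y -> R) (A : set Y) : \bar R :=
  ereal_sup [set r | exists y z, [/\ A y, A z & r = (d y z)%:E]].

Definition strip (R : realType) (X : topologicalType) (Y : tvsType R)
  (a : cord) (S : set (X * Y)) : Prop :=
  Sigma_class a S /\ forall x, convex_set (section S x : set Y).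

Definition graph (X Y : Type) (f : X -> Y) : set (X * Y) :=
  [set p | p.2 = f p.1].

(* Main.v *)
Require Import Defs.
From HB Require Import structures.
From mathcomp Require Import all_boot all_order all_algebra.
From mathcomp Require Import all_classical all_reals all_analysis.
From mathcomp Require Import ring lra.
Set Implicit Arguments. Unset Strict Implicit. Unset Printing Implicit Defensive.
Import Order.TTheory GRing.Theory Num.Theory.
Import numFieldNormedType.Exports.
Local Open Scope classical_set_scope.
Local Open Scope ring_scope.

(** If [a = b+1] and [f] is the limit of Baire-[b] functions [fs k], let [G n] be
    the set of [(x, y)] with [y - h x] in [V n] for some convex combination [h] of
    the [fs k], [k >= n], where [V n] is a decreasing base of convex open
    neighbourhoods of 0.  Rational weights suffice because [V n] is open, so [G n]
    is a countable union of preimages of open sets under Baire-[b] functions.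

    Conversely, [f x] lies in an open [U] iff some [G n x] is contained in one of
    countably many closed sets whose interiors cover [U]; hence preimages of open
    sets under [f] are [Sigma_(a+1)], and the Lebesgue-Hausdorff-Banach theorem
    applies.  For the latter, [f] is within [delta k] of a function [h k] with
    countably many values, each taken on a [Pi_a] set, so that [h k] is an
    eventually constant limit of functions [h k n] of class below [a].  The
    diagonal sequence [h 0 n + sum_(k < n) theta k (h k.+1 n - h k n)] converges to
    [f] if the continuous truncation [theta k] has values of size at most [2^-k]
    and fixes all small vectors. *)

(** * Countable ordinals *)

Scheme ole_olt_ind := Minimality for ole Sort Prop
  with olt_ole_ind := Minimality for olt Sort Prop.
Combined Scheme ole_olt_mutind from ole_olt_ind, olt_ole_ind.

Lemma ole_S_inv a b : ole (OS a) b -> olt a b.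
Proof. by move=> h; inversion h. Qed.

Lemma ole_L_inv f b n : ole (OL f) b -> ole (f n) b.
Proof. by move=> h; inversion h. Qed.

Lemma olt_S_inv a b : olt a (OS b) -> ole a b.
Proof. by move=> h; inversion h. Qed.

Lemma olt_L_inv a f : olt a (OL f) -> exists n, olt a (f n).
Proof. by move=> h; inversion h; exists n. Qed.

Lemma olt_Z_inv a : ~ olt a OZ.
Proof. by move=> h; inversion h. Qed.

Lemma ole_OL a f n : ole a (f n) -> ole a (OL f).
Proof.
elim: a => [|a _|g IH] h; first exact: ole_Z.
- by apply/ole_S/olt_L/ole_S_inv/h.
- by apply: ole_L => m; apply: IH; exact: ole_L_inv h.
Qed.

Lemma ole_refl a : ole a a.
Proof.
elim: a => [|a IH|f IH]; first exact: ole_Z.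
- exact/ole_S/olt_S.
- by apply: ole_L => n; apply: ole_OL (IH n).
Qed.

Lemma ole_olt_weak : (forall a b, ole a b -> ole a (OS b)) /\
  (forall a b, olt a b -> ole a b).
Proof.
apply: ole_olt_mutind => [b|a b _ h|f b _ h|a b _ h|a f n _ h] //.
- exact: ole_Z.
- exact/ole_S/olt_S.
- by apply: ole_L => n.
- exact: ole_OL h.
Qed.

Lemma oltW a b : olt a b -> ole a b.
Proof. exact: ole_olt_weak.2. Qed.

Lemma ole_olt_trans_aux :
  (forall a b, ole a b -> forall c, (ole b c -> ole a c) /\ (olt b c -> olt a c)) /\
  (forall a b, olt a b -> forall c, ole b c -> olt a c).
Proof.
have strict a b : (forall c, ole b c -> ole a c) -> forall c, olt b c -> olt a c.
  move=> h; elim=> [|c _|f IH].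
  - by move/olt_Z_inv.
  - by move/olt_S_inv => bc; apply/olt_S/h.
  - by move/olt_L_inv => [n /IH bn]; apply: olt_L bn.
have both a b : (forall c, ole b c -> ole a c) ->
    forall c, (ole b c -> ole a c) /\ (olt b c -> olt a c).
  by move=> h c; split; [exact: h|exact: strict].
apply: ole_olt_mutind => [b|a b _ h|f b _ h|a b _ h|a f n _ h].
- by apply: both => c _; exact: ole_Z.
- by apply: both => c /h; exact: ole_S.
- by apply: both => c bc; apply: ole_L => n; exact: (h n c).1.
- by move=> c /ole_S_inv; exact: (h c).2.
- by move=> c /ole_L_inv/h.
Qed.

Lemma ole_trans b a c : ole a b -> ole b c -> ole a c.
Proof. by move=> /ole_olt_trans_aux.1 /(_ c)[]. Qed.

Lemma ole_lt_trans b a c : ole a b -> olt b c -> olt a c.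
Proof. by move=> /ole_olt_trans_aux.1 /(_ c)[]. Qed.

Lemma olt_le_trans b a c : olt a b -> ole b c -> olt a c.
Proof. by move=> /ole_olt_trans_aux.2; exact. Qed.

Lemma oltS a : olt a (OS a).
Proof. exact/olt_S/ole_refl. Qed.

Lemma ole_or_olt a b : ole a b \/ olt b a.
Proof.
elim: a b => [b|a IH b|f IH b]; first by left; exact: ole_Z.
- suff [h|h] : olt a b \/ ole b a.
  + by left; exact: ole_S.
  + by right; exact: olt_S.
  elim: b => [|b _|f IHf]; first by right; exact: ole_Z.
  + by have [h|h] := IH b; [left; exact: olt_S|right; exact: ole_S].
  + have [[n h]|h] := pselect (exists n, olt a (f n)); first by left; apply: olt_L h.
    by right; apply: ole_L => n; have [an|//] := IHf n; case: h; exists n.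
- have [[n h]|h] := pselect (exists n, olt b (f n)); first by right; apply: olt_L h.
  by left; apply: ole_L => n; have [//|bn] := IH n b; case: h; exists n.
Qed.

Lemma olt_wf : well_founded olt.
Proof.
have accW a b : ole a b -> Acc olt b -> Acc olt a.
  by move=> ab [h]; constructor => c ca; apply: h; exact: olt_le_trans ab.
elim=> [|a IH|f IH]; constructor => c.
- by move/olt_Z_inv.
- by move/olt_S_inv/accW; apply.
- by move/olt_L_inv => [n cn]; apply: accW (IH n); exact: oltW.
Qed.

Lemma olt_irr a : ~ olt a a.
Proof. by elim/(well_founded_ind olt_wf): a => a IH aa; exact: (IH a). Qed.

Lemma omax_lt a b c : olt a c -> olt b c -> exists d, [/\ olt d c, ole a d & ole b d].
Proof.
move=> ac bc; have [ab|/oltW ba] := ole_or_olt a b.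
- by exists b; split => //; exact: ole_refl.
- by exists a; split => //; exact: ole_refl.
Qed.

Lemma ole_one a : ole Defs.one a \/ oeq a OZ.
Proof.
have [h|h] := ole_or_olt Defs.one a; first by left.
by right; split; [exact: olt_S_inv h|exact: ole_Z].
Qed.

Lemma ole_one_cases a : ole Defs.one a -> oeq a Defs.one \/ olt Defs.one a.
Proof. by have [h|h] := ole_or_olt a Defs.one; [left|right]. Qed.

(** * Borel classes *)

Definition dyadic_base (T : topologicalType) (B : nat -> T -> set T) : Prop :=
  [/\ forall x A, nbhs x A <-> exists n, B n x `<=` A,
      forall n x y, B n x y -> B n y x &
      forall n x y z, B n.+1 x y -> B n.+1 y z -> B n x z].

Definition dyadic (T : topologicalType) : Prop := exists B, @dyadic_base T B.

Lemma dyadic_refl (T : topologicalType) B n (x : T) : dyadic_base B -> B n x x.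
Proof. by move=> [nB _ _]; apply: (@nbhs_singleton _ x (B n x)); apply/nB; exists n. Qed.

Lemma dyadic_sub (T : topologicalType) B m n (x : T) :
  dyadic_base B -> (m <= n)%N -> B n x `<=` B m x.
Proof.
move=> dB; have [nB sB tB] := dB; elim: n => [|n IH]; first by rewrite leqn0 => /eqP ->.
rewrite leq_eqVlt => /orP[/eqP -> //|]; rewrite ltnS => /IH h y xy.
by apply: h; apply: tB xy _; exact: dyadic_refl.
Qed.

Lemma dyadic_prod (S T : topologicalType) : dyadic S -> dyadic T -> dyadic (S * T)%type.
Proof.
move=> [B dB] [C dC]; have [nB sB tB] := dB; have [nC sC tC] := dC.
exists (fun n x => [set y | B n x.1 y.1 /\ C n x.2 y.2]); split.
- move=> [x y] A; split.
  + move=> [[P Q]] /= [/nB[n Pn] /nC[m Qm]] PQ; exists (maxn n m) => -[u v] /= [Bu Cv].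
    apply: PQ; split => /=.
    * by apply: Pn; apply: dyadic_sub Bu => //; exact: leq_maxl.
    * by apply: Qm; apply: dyadic_sub Cv => //; exact: leq_maxr.
  + move=> [n Bn]; exists (B n x, C n y) => /=.
      by split; [apply/nB; exists n|apply/nC; exists n].
    by move=> [u v] [/= ? ?]; apply: Bn.
- by move=> n x y /= [/sB ? /sC].
- by move=> n x y z /= [b c] [b' c']; split; [exact: tB b'|exact: tC c'].
Qed.

Lemma dyadic_open (T : topologicalType) (U : set T) : dyadic T -> open U ->
  exists F : nat -> set T, [/\ forall m, closed (F m), forall m, F m `<=` F m.+1,
    forall m, F m `<=` U & forall x, U x -> exists m, nbhs x (F m)].
Proof.
move=> [B dB]; have [nB sB tB] := dB => oU.
exists (fun m => ~` \bigcup_(q in ~` U) (B m q)^°); split.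
- by move=> m; apply: open_closedC; apply: bigcup_open => q _; exact: open_interior.
- move=> m; apply: subsetC => x [q Uq Bx]; exists q => //.
  by apply: filterS Bx; exact: dyadic_sub.
- move=> m x; apply: contra_notP => Ux; exists x => //.
  by apply/nB; exists m.
- move=> x Ux; have /nB[n BU] : nbhs x U by exact: open_nbhs_nbhs.
  exists n.+1; apply/nB; exists n.+1 => y xy [q Uq] /interior_subset qy.
  by apply/Uq/BU; apply: tB xy _; exact: sB.
Qed.

Lemma Sigma_one_open (T : topologicalType) a (A : set T) :
  oeq a Defs.one -> Sigma_class a A -> open A.
Proof.
move=> [a1 _] h; inversion h => //; subst.
by have /olt_irr : olt a a by exact: ole_lt_trans a1 _.
Qed.

Lemma Sigma_ge_one (T : topologicalType) a (A : set T) :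
  Sigma_class a A -> ole Defs.one a.
Proof. by move=> h; inversion h; subst; [exact: H.2|exact: oltW]. Qed.

Lemma Sigma_le (T : topologicalType) a b (A : set T) : dyadic T ->
  ole a b -> Sigma_class a A -> Sigma_class b A.
Proof.
move=> dT ab h; inversion h as [? ? a1 oA|? ? ai C a1 aia sC AE]; subst.
- have [b1|b1] := ole_one_cases (ole_trans a1.2 ab); first exact: Sigma_open.
  have [F [cF _ FA AF]] := dyadic_open dT oA.
  apply: (@Sigma_union _ _ _ (fun=> Defs.one) F) => // [i|].
    by apply: Sigma_open; [split; exact: ole_refl|exact: closed_openC].
  apply/seteqP; split => [x /AF[m /nbhs_singleton Fx]|x [m _ /FA]//].
  by exists m.
- apply: (@Sigma_union _ _ _ ai C) => //.
  + exact: olt_le_trans ab.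
  + by move=> i; exact: olt_le_trans ab.
Qed.

Lemma Sigma_compl (T : topologicalType) a b (A : set T) :
  olt a b -> Sigma_class a A -> Sigma_class b (~` A).
Proof.
move=> ab h; apply: (@Sigma_union _ _ _ (fun=> a) (fun=> ~` A)) => //.
- exact: ole_lt_trans (Sigma_ge_one h) ab.
- by move=> _; rewrite setCK.
- by rewrite bigcup_const.
Qed.

Lemma Sigma_bigcup (T : topologicalType) a (A : nat -> set T) : ole Defs.one a ->
  (forall n, Sigma_class a (A n)) -> Sigma_class a (\bigcup_n A n).
Proof.
move=> /ole_one_cases[a1|a1] sA.
  by apply: Sigma_open => //; apply: bigcup_open => n _; exact: Sigma_one_open (sA n).
have dec n : exists p : (nat -> cord) * (nat -> set T),
    [/\ forall i, olt (p.1 i) a, forall i, Sigma_class (p.1 i) (~` p.2 i)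
      & A n = \bigcup_i p.2 i].
  move: (sA n) => h; inversion h as [? ? e _|? ? ai C _ aia sC AE]; subst.
    by case: (@olt_irr Defs.one); apply: olt_le_trans a1 e.1.
  by exists (ai, C).
have [p pP] := choice dec.
pose u k : nat * nat := odflt (0, 0)%N (unpickle k).
apply: (@Sigma_union _ _ _ (fun k => (p (u k).1).1 (u k).2)
  (fun k => (p (u k).1).2 (u k).2)) => // [k|k|].
- by have [] := pP (u k).1.
- by have [] := pP (u k).1.
- apply/seteqP; split => x [n _].
  + have [_ _ ->] := pP n; move=> [i _ xi]; exists (pickle (n, i)) => //.
    by rewrite /u pickleK.
  + by move=> xn; exists (u n).1 => //; have [_ _ ->] := pP (u n).1; exists (u n).2.
Qed.

Lemma Sigma_set0 (T : topologicalType) a : ole Defs.one a -> dyadic T ->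
  Sigma_class a (@set0 T).
Proof.
move=> a1 dT; apply: Sigma_le (dT) a1 _.
by apply: Sigma_open; [split; exact: ole_refl|exact: open0].
Qed.

Lemma Sigma_countable_bigcup (T : topologicalType) (I : countType) a (P : set I)
  (A : I -> set T) : dyadic T -> ole Defs.one a ->
  (forall i, P i -> Sigma_class a (A i)) -> Sigma_class a (\bigcup_(i in P) A i).
Proof.
move=> dT a1 sA.
pose C k := if unpickle k is Some i then [set x | P i /\ A i x] else set0.
have -> : \bigcup_(i in P) A i = \bigcup_k C k.
  apply/seteqP; split => x.
  + by move=> [i Pi Ax]; exists (pickle i) => //; rewrite /C pickleK.
  + by move=> [k _]; rewrite /C; case: unpickle => // i [Pi Ai]; exists i.
apply: Sigma_bigcup => // k; rewrite /C; case: unpickle => [i|]; last exact: Sigma_set0.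
have [Pi|nP] := pselect (P i).
  rewrite (_ : [set x | _] = A i); first exact: sA.
  by apply/seteqP; split => x //= [].
rewrite (_ : [set x | _] = set0); first exact: Sigma_set0.
by apply/seteqP; split => x //= [].
Qed.

Lemma Sigma_setU (T : topologicalType) a (A C : set T) : ole Defs.one a ->
  Sigma_class a A -> Sigma_class a C -> Sigma_class a (A `|` C).
Proof.
move=> a1 sA sC.
rewrite (_ : A `|` C = \bigcup_n (if n == 0%N then A else C)).
  by apply: Sigma_bigcup => // -[|n].
apply/seteqP; split => x; first by move=> [?|?]; [exists 0%N|exists 1%N].
by move=> [[|n] _ ?]; [left|right].
Qed.

Lemma Sigma_setI (T : topologicalType) a (A C : set T) : dyadic T ->
  Sigma_class a A -> Sigma_class a C -> Sigma_class a (A `&` C).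
Proof.
move=> dT sA sC; have [a1|a1] := ole_one_cases (Sigma_ge_one sA).
  by apply: Sigma_open => //; apply: openI; exact: Sigma_one_open a1 _.
inversion sA as [? ? e _|? ? ai A' _ aia sA' AE]; subst.
  by case: (@olt_irr Defs.one); apply: olt_le_trans a1 e.1.
inversion sC as [? ? e _|? ? bi C' _ bib sC' CE]; subst.
  by case: (@olt_irr Defs.one); apply: olt_le_trans a1 e.1.
rewrite (_ : _ `&` _ = \bigcup_(k in [set: nat * nat]) (A' k.1 `&` C' k.2)).
  apply: Sigma_countable_bigcup => //; first exact: oltW.
  move=> [i j] _ /=; have [c [ca ac bc]] := omax_lt (aia i) (bib j).
  rewrite -[_ `&` _]setCK; apply: Sigma_compl (ca) _; rewrite setCI.
  have sA1 := Sigma_le dT ac (sA' i).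
  by apply: Sigma_setU; [exact: Sigma_ge_one sA1|exact: sA1|exact: Sigma_le bc _].
apply/seteqP; split => x.
- by move=> [[i _ ?] [j _ ?]]; exists (i, j).
- by move=> [[i j] _ /= [? ?]]; split; [exists i|exists j].
Qed.

(** * Baire classes *)

Lemma Baire_le (X Y : topologicalType) a b (f : X -> Y) :
  ole a b -> Baire_class a f -> Baire_class b f.
Proof.
move=> ab h; inversion h as [? ? a0 cf|? ? ai fs a1 aia bfs lf]; subst.
- have [b1|b0] := ole_one b; last exact: Baire_cont.
  apply: (@Baire_lim _ _ _ _ (fun=> OZ) (fun=> f)) => // [_|_|x]; last exact: cvg_cst.
    exact: ole_S_inv b1.
  by apply: Baire_cont => //; split; exact: ole_refl.
- apply: (@Baire_lim _ _ _ _ ai fs) => // [|n]; first exact: ole_trans ab.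
  exact: olt_le_trans ab.
Qed.

Lemma continuous_Baire (X Y : topologicalType) a (f : X -> Y) :
  continuous f -> Baire_class a f.
Proof.
move=> cf; apply: (Baire_le (ole_Z a)).
by apply: Baire_cont => //; split; exact: ole_refl.
Qed.

Lemma Baire_comp (X Y Z : topologicalType) a (f : X -> Y) (g : Y -> Z) :
  continuous g -> Baire_class a f -> Baire_class a (g \o f).
Proof.
move=> cg; elim=> {a f} [a f a0 cf|a f ai fs a1 aia _ IH lf].
- by apply: Baire_cont => // x; apply: continuous_comp; [exact: cf|exact: cg].
- apply: (@Baire_lim _ _ _ _ ai (fun n => g \o fs n)) => // x.
  exact: (continuous_cvg _ (cg (f x)) (lf x)).
Qed.

Lemma Baire_precomp (X Y Z : topologicalType) a (f : X -> Y) (g : Z -> X) :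
  continuous g -> Baire_class a f -> Baire_class a (f \o g).
Proof.
move=> cg; elim=> {a f} [a f a0 cf|a f ai fs a1 aia _ IH lf].
- by apply: Baire_cont => // x; apply: continuous_comp; [exact: cg|exact: cf].
- by apply: (@Baire_lim _ _ _ _ ai (fun n => fs n \o g)) => // x; exact: lf.
Qed.

Lemma Baire_pair (X Y Z : topologicalType) a (f : X -> Y) (g : X -> Z) :
  Baire_class a f -> Baire_class a g -> Baire_class a (fun x => (f x, g x)).
Proof.
elim/(well_founded_ind olt_wf): a f g => a IH f g hf hg.
inversion hf as [? ? a0 cf|? ? ai fs a1 aia bfs lf]; subst;
  inversion hg as [? ? b0 cg|? ? bi gs b1 bia bgs lg]; subst.
- apply: Baire_cont => // x; apply: cvg_pair; [exact: cf|exact: cg].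
- by case: (@olt_irr OZ); apply: olt_le_trans a0.1; exact: ole_S_inv.
- by case: (@olt_irr OZ); apply: olt_le_trans b0.1; exact: ole_S_inv.
- have [c cP] := choice (fun n => omax_lt (aia n) (bia n)).
  apply: (@Baire_lim _ _ _ _ c (fun n x => (fs n x, gs n x))) => // [n|n|x].
  + by have [] := cP n.
  + have [ca ac bc] := cP n; apply: IH => //.
      exact: Baire_le ac (bfs n).
    exact: Baire_le bc (bgs n).
  + by apply: cvg_pair; [exact: lf|exact: lg].
Qed.

Lemma Baire_comp2 (X Y Z W : topologicalType) a (f : X -> Y) (g : X -> Z)
    (h : Y * Z -> W) : continuous h ->
  Baire_class a f -> Baire_class a g -> Baire_class a (fun x => h (f x, g x)).
Proof. by move=> ch hf hg; exact: Baire_comp ch (Baire_pair hf hg). Qed.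

Definition Baire_below (X Y : topologicalType) (a : cord) (f : X -> Y) : Prop :=
  exists2 b, olt b a & Baire_class b f.

Lemma Baire_below_cst (X Y : topologicalType) a (f : X -> Y) : ole Defs.one a ->
  continuous f -> Baire_below a f.
Proof. by move=> a1 cf; exists OZ; [exact: ole_S_inv|exact: continuous_Baire]. Qed.

Lemma Baire_below_comp (X Y Z : topologicalType) a (f : X -> Y) (g : Y -> Z) :
  continuous g -> Baire_below a f -> Baire_below a (g \o f).
Proof. by move=> cg [b ba bf]; exists b => //; exact: Baire_comp. Qed.

Lemma Baire_below_comp2 (X Y Z W : topologicalType) a (f : X -> Y) (g : X -> Z)
    (h : Y * Z -> W) : continuous h ->
  Baire_below a f -> Baire_below a g -> Baire_below a (fun x => h (f x, g x)).
Proof.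
move=> ch [b ba bf] [c ca cg]; have [e [ea be ce]] := omax_lt ba ca.
exists e => //; apply: Baire_comp2 => //; [exact: Baire_le bf|exact: Baire_le cg].
Qed.

Lemma Baire_below_lim (X Y : topologicalType) a (fs : nat -> X -> Y) (f : X -> Y) :
  ole Defs.one a -> (forall n, Baire_below a (fs n)) ->
  (forall x, (fun n => fs n x) @ \oo --> f x) -> Baire_class a f.
Proof.
move=> a1 bfs lf.
have dec n : exists c, olt c a /\ Baire_class c (fs n).
  by have [c ca cf] := bfs n; exists c.
have [c cP] := choice dec.
by apply: (@Baire_lim _ _ _ _ c fs) => // n; have [] := cP n.
Qed.

Lemma Baire_preimage_open (X Y : topologicalType) a (f : X -> Y) (U : set Y) :
  dyadic X -> dyadic Y -> Baire_class a f -> open U -> Sigma_class (OS a) (f @^-1` U).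
Proof.
move=> dX dY hf; elim: hf U => {a f} [a f a0 cf|a f ai fs a1 aia _ IH lf] U oU.
  apply: Sigma_open; last by apply: open_comp => // x _; exact: cf.
  split; first by apply/ole_S/olt_S/a0.1.
  by apply/ole_S/olt_S/ole_Z.
have [F [cF _ FU UF]] := dyadic_open dY oU.
have S1 : ole Defs.one (OS a) by apply/ole_S/olt_S/ole_Z.
rewrite (_ : _ @^-1` _ = \bigcup_(k in [set: nat * nat])
    ~` \bigcup_n (fs (k.2 + n)%N @^-1` (~` F k.1))).
  apply: Sigma_countable_bigcup => // -[m N] _ /=; apply: Sigma_compl (oltS a) _.
  apply: Sigma_bigcup => // n; apply: (Sigma_le dX _ (IH (N + n)%N _ _)).
    exact: ole_S.
  exact: closed_openC.
apply/seteqP; split => x /=.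
- move=> /UF[m Fm]; have [N _ NF] := lf x _ Fm; exists (m, N) => //= -[n _ /=]; apply.
  by apply: NF => /=; exact: leq_addr.
- move=> [[m N] _ /= h]; apply: (FU m).
  apply: (@closed_cvg _ _ \oo _ (fun n => fs n x) (F m) (cF m) _ (f x) (lf x)).
  exists N => //= n Nn; apply: contrapT => nF; apply: h; exists (n - N)%N => //=.
  by rewrite subnKC.
Qed.

(** * Indicators of ambiguous sets *)

Lemma half_exp_lt (R : realType) (e : R) : 0 < e -> exists n, 2^-1 ^+ n < e :> R.
Proof.
move=> e0; have h : `|2^-1| < 1 :> R by rewrite ger0_norm// invf_lt1// ltr1n.
have [N _ hN] := cvgr_lt (0 : R) (cvg_expr h) e e0.
by exists N; apply: hN => /=.
Qed.

Lemma half_exp_add (R : realType) n : 2^-1 ^+ n.+1 + 2^-1 ^+ n.+1 = 2^-1 ^+ n :> R.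
Proof. by rewrite -mulr2n -[_ *+ 2]mulr_natl exprS mulrA mulfV ?mul1r// pnatr_eq0. Qed.

Lemma half_exp_gt0 (R : realType) n : 0 < 2^-1 ^+ n :> R.
Proof. by rewrite exprn_gt0// invr_gt0. Qed.

Lemma dyadic_pseudometric (R : realType) (X : pseudoMetricType R) : dyadic X.
Proof.
exists (fun n x => ball x (2^-1 ^+ n)); split.
- move=> x A; split.
  + move=> /nbhs_ballP[e /= e0 eA]; have [n ne] := half_exp_lt e0; exists n.
    by apply: subset_trans eA; apply: le_ball; exact: ltW.
  + by move=> [n nA]; apply/nbhs_ballP; exists (2^-1 ^+ n) => //=; exact: half_exp_gt0.
- by move=> n x y; exact: ball_sym.
- by move=> n x y z xy yz; rewrite -half_exp_add; exact: ball_triangle xy yz.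
Qed.

Lemma continuous_pair (T U V : topologicalType) (f : T -> U) (g : T -> V) x :
  {for x, continuous f} -> {for x, continuous g} ->
  {for x, continuous (fun t => (f t, g t))}.
Proof. exact: cvg_pair. Qed.

Lemma continuous_addr (T : topologicalType) (R : realType) (Y : tvsType R)
    (f g : T -> Y) :
  continuous f -> continuous g -> continuous (fun x => f x + g x).
Proof.
move=> cf cg x; apply: (@continuous_comp _ _ _ (fun x => (f x, g x))
  (fun p : Y * Y => p.1 + p.2)); last exact: add_continuous.
by apply: continuous_pair; [exact: cf|exact: cg].
Qed.

Lemma continuous_subr (T : topologicalType) (R : realType) (Y : tvsType R)
    (f g : T -> Y) :
  continuous f -> continuous g -> continuous (fun x => f x - g x).
Proof.
move=> cf cg x; apply: (@continuous_comp _ _ _ (fun x => (f x, g x))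
  (fun p : Y * Y => p.1 - p.2)); last exact: sub_continuous.
by apply: continuous_pair; [exact: cf|exact: cg].
Qed.

Lemma continuous_scaler (T : topologicalType) (R : realType) (Y : tvsType R)
    (k : T -> R^o) (f : T -> Y) :
  continuous k -> continuous f -> continuous (fun x => k x *: f x).
Proof.
move=> ck cf x; apply: (@continuous_comp _ _ _ (fun x => (k x, f x))
  (fun p : R^o * Y => p.1 *: p.2)); last exact: scale_continuous.
by apply: continuous_pair; [exact: ck|exact: cf].
Qed.

Lemma continuous_barycenter (R : realType) (Y : tvsType R) (c : Y) :
  continuous (fun p : R^o * Y => p.1 *: c + (1 - p.1) *: p.2).
Proof.
have c1 : continuous (fun p : R^o * Y => p.1) by move=> p; exact: cvg_fst.
have c2 : continuous (fun p : R^o * Y => p.2) by move=> p; exact: cvg_snd.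
apply: continuous_addr; apply: continuous_scaler => //.
- by move=> p; exact: cvg_cst.
- by apply: continuous_subr => // p; exact: cvg_cst.
Qed.

Definition indicator_approx (R : realType) (X : topologicalType) (b : cord)
    (F : set X) (phi : nat -> X -> R^o) : Prop :=
  [/\ forall n, Baire_below b (phi n), forall n x, F x -> phi n x = 1 &
      forall x, ~ F x -> exists N, forall n, (N <= n)%N -> phi n x = 0].

(* A continuous substitute for searching the first index [i >= m] with
   [phi i x = 1]; [j] bounds the length of the search. *)
Fixpoint select (R : realType) (X : Type) (Y : tvsType R) (phi : nat -> X -> R^o)
    (y : nat -> Y) (j m : nat) (x : X) : Y :=
  if j is j'.+1 then phi m x *: y m + (1 - phi m x) *: select phi y j' m.+1 x else 0.

Lemma select_first (R : realType) (X : Type) (Y : tvsType R)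
    (phi : nat -> X -> R^o) (y : nat -> Y) (x : X) (m0 j m : nat) :
  (forall i, (i < m0)%N -> phi i x = 0) -> phi m0 x = 1 ->
  (m <= m0 < m + j)%N -> select phi y j m x = y m0.
Proof.
move=> phi0 phi1; elim: j m => [|j IH] m /andP[mm0].
  by rewrite addn0 ltnNge mm0.
rewrite addnS ltnS => m0mj /=; move: mm0; rewrite leq_eqVlt => /orP[/eqP ->|mm0].
  by rewrite phi1 scale1r subrr scale0r addr0.
by rewrite (phi0 _ mm0) scale0r add0r subr0 scale1r IH// mm0.
Qed.

Lemma Baire_below_select (R : realType) (X : topologicalType) (Y : tvsType R) b
    (phi : nat -> X -> R^o) (y : nat -> Y) j m : ole Defs.one b ->
  (forall i, Baire_below b (phi i)) -> Baire_below b (select phi y j m).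
Proof.
move=> b1 bphi; elim: j m => [|j IH] m /=.
  by apply: Baire_below_cst => // x; exact: cvg_cst.
exact: Baire_below_comp2 (@continuous_barycenter R Y (y m)) (bphi m) (IH m.+1).
Qed.

Lemma Baire_below_selection (R : realType) (X : topologicalType) (Y : tvsType R) b
    (F : nat -> set X) (y : nat -> Y) : ole Defs.one b ->
  (forall m, exists phi : nat -> X -> R^o, indicator_approx b (F m) phi) ->
  (forall x, exists m, F m x) ->
  exists h : nat -> X -> Y, (forall n, Baire_below b (h n)) /\
    forall x, exists2 m, F m x & exists N, forall n, (N <= n)%N -> h n x = y m.
Proof.
move=> b1 /choice[phi phiP] cov.
exists (fun n => select (fun m => phi m n) y n 0%N); split=> [n|x].
  by apply: Baire_below_select => // i; have [] := phiP i.
have exF : exists m, `[< F m x >] by have [m Fm] := cov x; exists m; apply/asboolP.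
case: (ex_minnP exF) => m0 /asboolP Fm0 m0min; exists m0 => //.
have [N hN] : exists N, forall n, (N <= n)%N -> forall i, (i < m0)%N -> phi i n x = 0.
  have : forall i, (i < m0)%N -> ~ F i x.
    by move=> i; rewrite ltnNge => /negP im /asboolP /m0min.
  elim: (m0) => [|m IH] nF; first by exists 0%N.
  have [|N hN] := IH; first by move=> i im; apply: nF; exact: ltnW.
  have [_ _ /(_ x (nF m (ltnSn m)))[N' hN']] := phiP m.
  exists (maxn N N') => n; rewrite geq_max => /andP[Nn N'n] i.
  rewrite ltnS leq_eqVlt => /orP[/eqP ->|im]; first exact: hN'.
  exact: hN.
exists (maxn N m0.+1) => n; rewrite geq_max => /andP[Nn m0n].
apply: select_first; first by move=> i; exact: hN.
  by have [_ /(_ n x Fm0)] := phiP m0.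
by rewrite leq0n add0n.
Qed.

Lemma Sigma_S_inv (X : topologicalType) b (A : set X) : dyadic X -> ole Defs.one b ->
  Sigma_class (OS b) A ->
  exists F : nat -> set X, (forall i, Sigma_class b (~` F i)) /\ A = \bigcup_i F i.
Proof.
move=> dX b1 h; inversion h as [? ? e _|? ? ai C _ aia sC AE]; subst.
  by case: (@olt_irr Defs.one); apply: ole_lt_trans b1 (ole_S_inv e.1).
by exists C; split => // i; apply: Sigma_le dX _ (sC i); exact/olt_S_inv.
Qed.

Lemma indicator_approx_one (R : realType) (X : pseudoMetricType R) b (F : set X) :
  oeq b Defs.one -> Sigma_class b (~` F) ->
  exists phi : nat -> X -> R^o, indicator_approx b F phi.
Proof.
move=> b1 /(Sigma_one_open b1) oF.
have [K [cK mK KF FK]] := dyadic_open (dyadic_pseudometric X) oF.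
have cF : closed F by rewrite -(setCK F); exact: open_closedC.
have dec n : exists phi : X -> R, [/\ continuous phi,
    (forall x, F x -> phi x = 1) & (forall x, K n x -> phi x = 0)].
  have KF0 : K n `&` F = set0 by apply/seteqP; split => x // [/KF].
  have [phi [cphi phi0 phi1 _]] :=
    urysohn_ext_itv (@pseudometric_normal R X) (cK n) cF KF0 (@ltr01 R).
  by exists phi; split => // x ?; [apply: phi1|apply: phi0]; exists x.
have [phi phiP] := choice dec; exists phi; split.
- by move=> n; apply: Baire_below_cst; [exact: b1.2|have [] := phiP n].
- by move=> n x Fx; have [_ /(_ x Fx)] := phiP n.
- move=> x /FK[N /nbhs_singleton KN]; exists N => n Nn.
  have [_ _ -> //] := phiP n.
  elim: n Nn => [|n IH]; first by rewrite leqn0 => /eqP <-.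
  by rewrite leq_eqVlt => /orP[/eqP <- //|/IH]; exact: mK.
Qed.

Lemma Baire_indic_of_approx (R : realType) (X : topologicalType) b (A : set X) :
  dyadic X -> ole Defs.one b ->
  (forall F : set X, Sigma_class b (~` F) ->
     exists phi : nat -> X -> R^o, indicator_approx b F phi) ->
  Sigma_class (OS b) A -> Sigma_class (OS b) (~` A) ->
  Baire_class b (\1_A : X -> R^o).
Proof.
move=> dX b1 approx /(Sigma_S_inv dX b1)[F [sF AF]] /(Sigma_S_inv dX b1)[H [sH AH]].
pose K m := if odd m then H m./2 else F m./2.
have KA m x : K m x -> (x \in A) = ~~ odd m.
  rewrite /K; case: (odd m) => /= h; last by apply/mem_set; rewrite AF; exists m./2.
  by apply: memNset => /=; rewrite -[~ _]/((~` A) x) AH; exists m./2.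
have [||h [bh hK]] := @Baire_below_selection R X R^o b K (fun m => (~~ odd m)%:R) b1.
- by move=> m; apply: approx; rewrite /K; case: ifP.
- move=> x; have [Ax|] := pselect (A x).
  + move: (Ax); rewrite AF => -[m _ Fm]; exists m.*2.
    by rewrite /K odd_double doubleK.
  + rewrite -[~ _]/((~` A) x) AH => -[m _ Hm]; exists m.*2.+1.
    by rewrite /K /= odd_double uphalf_double.
- apply: (Baire_below_lim b1 bh) => x; have [m Km [N hN]] := hK x.
  apply: cvg_near_cst; exists N => //= n /hN ->.
  by rewrite indicE (KA _ _ Km).
Qed.

(* An induction on [b]: a [Pi_b] set is a decreasing intersection of ambiguous
   sets of lower class, whose indicators are Baire of lower class. *)
Lemma indicator_approx_exists (R : realType) (X : pseudoMetricType R) b (F : set X) :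
  Sigma_class b (~` F) -> exists phi : nat -> X -> R^o, indicator_approx b F phi.
Proof.
have dX := dyadic_pseudometric X.
elim/(well_founded_ind olt_wf): b F => b IH F sF.
have [b1|b1] := ole_one_cases (Sigma_ge_one sF); first exact: indicator_approx_one.
inversion sF as [? ? e _|? ? ai C _ aia sC FC]; subst.
  by case: (@olt_irr Defs.one); apply: olt_le_trans b1 e.1.
pose K n := \bigcap_(i < n) ~` C i.
have sK n : exists c, olt c b /\ Sigma_class c (K n).
  elim: n => [|n [c [cb sK]]].
    exists Defs.one; split => //; rewrite /K bigcap_mkord big_ord0.
    by apply: Sigma_open; [split; exact: ole_refl|exact: openT].
  have [d [db cd ad]] := omax_lt cb (aia n); exists d; split => //.
  rewrite (_ : K n.+1 = K n `&` ~` C n).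
    by apply: Sigma_setI => //; [exact: Sigma_le cd _|exact: Sigma_le ad _].
  by rewrite /K !bigcap_mkord big_ord_recr.
exists (fun n => \1_(K n)); split.
- move=> n; have [c [cb sKc]] := sK n; exists c => //.
  apply: Baire_indic_of_approx => //; first exact: Sigma_ge_one sKc.
  + by move=> G; exact: IH.
  + by apply: Sigma_le dX _ sKc; exact/oltW/oltS.
  + exact: Sigma_compl (oltS c) sKc.
- move=> n x Fx; rewrite indicE mem_set// => i _ Ci.
  by have : (~` F) x by rewrite FC; exists i.
- move=> x nFx; have : (~` F) x by [].
  rewrite FC => -[i _ Ci]; exists i.+1 => n ni.
  by rewrite indicE memNset// => /(_ i ni).
Qed.

(** * The Lebesgue-Hausdorff-Banach theorem *)

Lemma frechet_ge0 (R : realType) (Y : tvsType R) (d : Y -> Y -> R) y z :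
  frechet_metric d -> 0 <= d y z.
Proof.
move=> [d0 [ds [dt _]]]; have := dt y z y; rewrite (d0 y y).2//= (ds z y).
by rewrite -mulr2n pmulrn_lge0.
Qed.

Lemma frechet_subr (R : realType) (Y : tvsType R) (d : Y -> Y -> R) y z :
  frechet_metric d -> d y z = d (y - z) 0.
Proof. by move=> [_ [_ [_ [di _]]]]; rewrite -(di (y - z) 0 z) subrK add0r. Qed.

Lemma frechet_nbhs_ball (R : realType) (Y : tvsType R) (d : Y -> Y -> R) y e :
  frechet_metric d -> 0 < e -> nbhs y [set z | d y z < e].
Proof. by move=> [_ [_ [_ [_ [nd _]]]]] e0; apply/nd; exists e. Qed.

Lemma frechet_open_ball (R : realType) (Y : tvsType R) (d : Y -> Y -> R) y e :
  frechet_metric d -> open [set z | d y z < e].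
Proof.
move=> dF; have [_ [_ [dt _]]] := dF.
rewrite openE => z /= yz; have e0 : 0 < e - d y z by rewrite subr_gt0.
apply: filterS (frechet_nbhs_ball z dF e0) => w /= zw.
by apply: le_lt_trans (dt y z w) _; rewrite -ltrBrDl.
Qed.

Lemma frechet_dyadic (R : realType) (Y : tvsType R) (d : Y -> Y -> R) :
  frechet_metric d -> dyadic Y.
Proof.
move=> dF; have [_ [ds [dt [_ [nd _]]]]] := dF.
exists (fun n y => [set z | d y z < 2^-1 ^+ n]); split.
- move=> y A; split.
  + move=> /nd[e e0 eA]; have [n ne] := half_exp_lt e0; exists n.
    by apply: subset_trans eA => z /= /lt_trans; apply.
  + by move=> [n nA]; apply/nd; exists (2^-1 ^+ n) => //; exact: half_exp_gt0.
- by move=> n y z /=; rewrite ds.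
- move=> n x y z /= xy yz; apply: le_lt_trans (dt x y z) _.
  by rewrite -half_exp_add ltrD.
Qed.

Lemma frechet_continuous_dist0 (R : realType) (Y : tvsType R) (d : Y -> Y -> R) :
  frechet_metric d -> continuous (fun z => d z 0 : R^o).
Proof.
move=> dF; have [_ [ds [dt _]]] := dF => z.
apply/cvgrPdist_lt => e e0; apply: filterS (frechet_nbhs_ball z dF e0) => w /= zw.
have := dt z w 0; have := dt w z 0; rewrite (ds w z) => h1 h2.
by rewrite ltr_norml; apply/andP; split; lra.
Qed.

Lemma convex_set_onem (R : realType) (Y : lmodType R) (A : set Y) (t : R) y z :
  convex_set A -> 0 <= t -> t <= 1 -> A y -> A z -> A (t *: y + (1 - t) *: z).
Proof.
move=> cA t0 t1 Ay Az.
by have /set_mem := cA y z (Itv01 t0 t1) (mem_set Ay) (mem_set Az).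
Qed.

Lemma convex_nbhs (R : realType) (Y : tvsType R) (y : Y) (A : set Y) : nbhs y A ->
  exists V : set Y, [/\ open V, V y, convex_set (V : set Y) & V `<=` A].
Proof.
move=> yA; have [B cB [oB bB]] := @locally_convex R Y.
have [V [BV Vy] VA] := bB y A yA.
by exists V; split => //; [exact: oB|exact/cB/mem_set].
Qed.

Lemma frechet_truncation (R : realType) (Y : tvsType R) (d : Y -> Y -> R) (r : R) :
  frechet_metric d -> 0 < r ->
  exists e (theta : Y -> Y), [/\ 0 < e, e <= r, continuous theta,
    forall z, d z 0 <= e -> theta z = z & forall z, d (theta z) 0 <= r].
Proof.
move=> dF r0; have [d0 [ds [dt [_ [nd _]]]]] := dF.
have [V [oV V0 cV Vr]] := convex_nbhs (frechet_nbhs_ball 0 dF r0).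
have /nd[s s0 sV] : nbhs (0 : Y) V by exact: open_nbhs_nbhs.
pose e := Num.min (s / 2) r.
have e0 : 0 < e by rewrite lt_min divr_gt0.
have es : 2 * e <= s by rewrite mulrC -ler_pdivlMr// ge_min lexx.
pose c z : R^o := Num.max 0 (Num.min 1 (2 - d z 0 / e)).
have c0 z : 0 <= c z by rewrite le_max lexx.
have c1 z : c z <= 1 by rewrite ge_max ler01 ge_min lexx.
exists e, (fun z => c z *: z); split => //; first by rewrite ge_min lexx orbT.
- apply: continuous_scaler; last by move=> z; exact: cvg_id.
  move=> z; apply: (@continuous_max R^o Y (cst 0) _ z); first exact: cvg_cst.
  apply: (@continuous_min R^o Y (cst 1) _ z); first exact: cvg_cst.
  apply: (@continuous_comp _ R^o R^o (fun z => d z 0) (fun t : R => 2 - t / e)).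
    exact: frechet_continuous_dist0.
  by apply: cvgB; [exact: cvg_cst|exact: mulrr_continuous].
- move=> z ze; rewrite /c; have -> : Num.min 1 (2 - d z 0 / e) = 1.
    apply/min_idPl; rewrite lerBrDl -lerBrDr; have -> : 2 - 1 = 1 :> R by ring.
    by rewrite ler_pdivrMr// mul1r.
  by rewrite (max_idPr _) ?ler01// scale1r.
- move=> z; have [zs|sz] := ltP (d z 0) s; last first.
    have -> : c z = 0.
      rewrite /c; apply/max_idPl; rewrite ge_min; apply/orP; right.
      by rewrite subr_le0 ler_pdivlMr//; exact: le_trans es sz.
    by rewrite scale0r (d0 0 0).2// ltW.
  have Vz : V z by apply: sV => /=; rewrite ds.
  have := convex_set_onem cV (c0 z) (c1 z) Vz V0; rewrite scaler0 addr0 => /Vr /=.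
  by rewrite ds => /ltW.
Qed.

Lemma separable_dense_seq (R : realType) (Y : tvsType R) (d : Y -> Y -> R) :
  frechet_metric d -> separable_space Y ->
  exists q : nat -> Y, forall y e, 0 < e -> exists i, d y (q i) < e.
Proof.
move=> dF [D [/countable_injP[u uinj] dD]].
exists (fun n => xget 0 [set y | D y /\ u y = n]) => y e e0.
have [|z [yz Dz]] := dD _ _ (frechet_open_ball y e dF).
  by have [d0 _] := dF; exists y; rewrite /= (d0 y y).2.
exists (u z); case: xgetP => [w _ [Dw uw]|/(_ z)[]//].
by rewrite (_ : w = z)//; apply: uinj => //; exact: mem_set.
Qed.

Lemma Baire_below_step (R : realType) (X : pseudoMetricType R) (Y : tvsType R)
    (d : Y -> Y -> R) a (f : X -> Y) (e : R) :
  frechet_metric d -> separable_space Y -> ole Defs.one a ->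
  (forall U, open U -> Sigma_class (OS a) (f @^-1` U)) -> 0 < e ->
  exists h : nat -> X -> Y, (forall n, Baire_below a (h n)) /\
    forall x, exists y, d (f x) y < e /\ exists N, forall n, (N <= n)%N -> h n x = y.
Proof.
move=> dF sY a1 sf e0; have [_ [ds _]] := dF.
have [q qP] := separable_dense_seq dF sY; have dX := dyadic_pseudometric X.
have [F FP] := choice (fun i => Sigma_S_inv dX a1 (sf _ (frechet_open_ball (q i) e dF))).
pose u k : nat * nat := odflt (0, 0)%N (unpickle k).
have [||h [bh hP]] := @Baire_below_selection R X Y a
    (fun m => F (u m).1 (u m).2) (fun m => q (u m).1) a1.
- by move=> m; apply: indicator_approx_exists; have [] := FP (u m).1.
- move=> x; have [i di] := qP (f x) e e0; have [_ Fi] := FP i.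
  have : (f @^-1` [set z | d (q i) z < e]) x by rewrite /= ds.
  by rewrite Fi => -[j _ Fx]; exists (pickle (i, j)); rewrite /u pickleK.
- exists h; split => // x; have [m Fm hN] := hP x; exists (q (u m).1); split => //.
  have [_ Fi] := FP (u m).1; rewrite ds.
  by have : (\bigcup_j F (u m).1 j) x by [exists (u m).2]; rewrite -Fi.
Qed.

Fixpoint partial_sum (Y : zmodType) (T : Type) (theta : nat -> Y -> Y)
    (h : nat -> T -> Y) (k : nat) (x : T) : Y :=
  if k is j.+1 then partial_sum theta h j x + theta j (h j.+1 x - h j x) else h 0%N x.

Lemma Baire_below_partial_sum (R : realType) (X : topologicalType) (Y : tvsType R) a
    (theta : nat -> Y -> Y) (h : nat -> X -> Y) k :
  (forall j, continuous (theta j)) -> (forall j, Baire_below a (h j)) ->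
  Baire_below a (partial_sum theta h k).
Proof.
move=> ct bh; elim: k => [|k IH] //=.
have c1 : continuous (fun p : Y * Y => p.1) by move=> p; exact: cvg_fst.
have c2 : continuous (fun p : Y * Y => p.2) by move=> p; exact: cvg_snd.
apply: (@Baire_below_comp2 _ _ _ _ _ _ _ (fun p : Y * Y => p.1 + p.2)) => //.
  exact: add_continuous.
apply: (@Baire_below_comp _ _ _ _ _ (theta k) (ct k)).
exact: (@Baire_below_comp2 _ _ _ _ _ _ _ _ (@sub_continuous Y)).
Qed.

Lemma partial_sum_dist (R : realType) (Y : tvsType R) (d : Y -> Y -> R) (T : Type)
    (theta : nat -> Y -> Y) (h : nat -> T -> Y) K i x :
  frechet_metric d -> (forall j z, d (theta j z) 0 <= 2^-1 ^+ j) ->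
  d (partial_sum theta h K x) (partial_sum theta h (K + i) x) <=
    2 * 2^-1 ^+ K - 2 * 2^-1 ^+ (K + i).
Proof.
move=> dF th; have [d0 [ds [dt _]]] := dF.
elim: i => [|i IH]; first by rewrite addn0 subrr (d0 _ _).2.
rewrite addnS /=; set G := partial_sum theta h (K + i) x; set t := theta _ _.
have st : d G (G + t) <= 2^-1 ^+ (K + i).
  by rewrite ds (frechet_subr _ _ dF) addrAC subrr add0r; exact: th.
have := dt (partial_sum theta h K x) G (G + t); have := half_exp_add R (K + i).
rewrite -/G in IH; lra.
Qed.

Lemma Baire_of_preimage_open (R : realType) (X : pseudoMetricType R) (Y : tvsType R)
    (d : Y -> Y -> R) a (f : X -> Y) :
  frechet_metric d -> separable_space Y -> ole Defs.one a ->
  (forall U, open U -> Sigma_class (OS a) (f @^-1` U)) -> Baire_class a f.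
Proof.
move=> dF sY a1 sf; have [d0 [ds [dt [_ [nd _]]]]] := dF.
have [e eP] := choice (fun k => frechet_truncation dF (half_exp_gt0 R k)).
have [theta thP] := choice eP.
pose delta := fix delta k := if k is j.+1 then Num.min (delta j) (e k / 2) else e 0%N / 2.
have delta0 k : 0 < delta k.
  have e0 j : 0 < e j by have [] := thP j.
  by elim: k => [|k IH] /=; rewrite ?lt_min ?IH divr_gt0.
have deltae k : delta k <= e k / 2 by case: k => //= k; rewrite ge_min lexx orbT.
have deltah k : delta k <= 2^-1 ^+ k.
  apply: le_trans (deltae k) _; have [e0 ek _ _ _] := thP k.
  by apply: le_trans ek; lra.
have [h hP] := choice (fun k => Baire_below_step dF sY a1 sf (delta0 k)).
pose g n := partial_sum theta (fun k => h k n) n.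
apply: (@Baire_below_lim _ _ _ g) => // [n|x].
  apply: Baire_below_partial_sum => k; first by have [] := thP k.
  by have [] := hP k.
have [y yP] := choice (fun k => (hP k).2 x).
have head K : exists N, forall n, (N <= n)%N -> forall k, (k <= K)%N -> h k n x = y k.
  elim: K => [|K [N hN]].
    by have [_ [N hN]] := yP 0%N; exists N => n /hN ? k; rewrite leqn0 => /eqP ->.
  have [_ [N' hN']] := yP K.+1; exists (maxn N N') => n.
  rewrite geq_max => /andP[/hN {}hN /hN' {}hN'] k.
  by rewrite leq_eqVlt => /orP[/eqP ->//|]; exact: hN.
have sum_head K n : (forall k, (k <= K)%N -> h k n x = y k) ->
    partial_sum theta (fun k => h k n) K x = y K.
  elim: K => [|K IH] hy /=; first exact: hy.
  rewrite IH; last by move=> k kK; apply: hy; exact: leqW.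
  rewrite !hy//; have [_ _ _ -> //] := thP K; first by rewrite addrC subrK.
  rewrite -(frechet_subr _ _ dF); have [yK _] := yP K; have [yK1 _] := yP K.+1.
  have := dt (y K.+1) (f x) (y K); rewrite (ds (y K.+1) (f x)) => tri.
  have := deltae K; have : delta K.+1 <= delta K by rewrite /= ge_min lexx.
  lra.
move=> A /nd[r r0 rA].
have [K Kr] : exists K, 2^-1 ^+ K < r / 3 by apply: half_exp_lt; rewrite divr_gt0.
have [N hN] := head K; exists (maxn N K) => // n /=.
rewrite geq_max => /andP[Nn Kn]; apply: rA => /=.
have := dt (f x) (y K) (g n x); have [yK _] := yP K.
have thd j z : d (theta j z) 0 <= 2^-1 ^+ j by have [] := thP j.
have := @partial_sum_dist R Y d X theta (fun k => h k n) K (n - K) x dF thd.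
rewrite (subnKC Kn) (sum_head K n (hN n Nn)) -/(g n).
have := deltah K; have := half_exp_gt0 R n.
lra.
Qed.

(** * Convex tubes around Baire functions *)

Definition unit_rat (R : realType) (r : rat) : R :=
  if (0 <= ratr r :> R) && (ratr r <= 1 :> R) then ratr r else 1.

Lemma unit_rat_itv (R : realType) r : 0 <= unit_rat R r /\ unit_rat R r <= 1.
Proof. by rewrite /unit_rat; case: ifP => [/andP[]//|_]; rewrite ler01 lexx. Qed.

Lemma unit_rat1 (R : realType) : unit_rat R 1 = 1.
Proof. by rewrite /unit_rat rmorph1; case: ifP. Qed.

Lemma unit_rat_dense (R : realType) (Y : topologicalType) (phi : R^o -> Y) (V : set Y)
    (t : R) :
  continuous phi -> open V -> 0 <= t -> t <= 1 -> V (phi t) ->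
  exists r, V (phi (unit_rat R r)).
Proof.
move=> cphi oV t0 t1 Vt; have [t00|tn0] := eqVneq t 0.
  by exists 0; rewrite /unit_rat rmorph0 lexx ler01 -t00.
have {tn0}t0 : 0 < t by rewrite lt_def tn0.
have /nbhs_ballP[e /= e0 eV] : nbhs (t : R^o) (phi @^-1` V).
  by apply: cphi; exact: open_nbhs_nbhs.
have [|r] := @rat_in_itvoo R (Num.max 0 (t - e)) t.
  by rewrite gt_max t0 ltrBlDr ltrDl.
rewrite in_itv /= gt_max => /andP[/andP[r0 er] rt]; exists r.
rewrite /unit_rat (ltW r0) (le_trans (ltW rt) t1) /=; apply: eV.
by rewrite /ball /= ltr_norml; apply/andP; split; lra.
Qed.

(* Iterated binary convex combinations with rational weights: [comb_index j]
   codes those of nesting depth exactly [j]. *)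
Fixpoint comb_index (j : nat) : countType :=
  if j is j'.+1 then (comb_index j' * comb_index j' * rat)%type : countType else nat.

Fixpoint comb (R : realType) (X : Type) (Y : lmodType R) (f : nat -> X -> Y) (j : nat) :
    comb_index j -> X -> Y :=
  match j with
  | 0 => fun i x => f i x
  | j'.+1 => fun i x => unit_rat R i.2 *: comb f i.1.1 x +
                        (1 - unit_rat R i.2) *: comb f i.1.2 x
  end.

Lemma comb_lift (R : realType) (X : Type) (Y : lmodType R) (f : nat -> X -> Y) j k
    (i : comb_index j) :
  exists i' : comb_index (k + j), comb f i' = comb f i.
Proof.
elim: k => [|k [i' <-]]; first by exists i.
exists (i', i', 1); apply/funext => x /=.
by rewrite unit_rat1 scale1r subrr scale0r addr0.
Qed.

Lemma comb_reindex (R : realType) (X : Type) (Y : lmodType R) (f : nat -> X -> Y)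
    (s : nat -> nat) j (i : comb_index j) :
  exists i' : comb_index j, comb f i' = comb (fun k => f (s k)) i.
Proof.
elim: j i => [|j IH] i; first by exists (s i).
by have [p ep] := IH i.1.1; have [q eq] := IH i.1.2; exists (p, q, i.2); rewrite /= ep eq.
Qed.

Lemma comb_convex (R : realType) (X : Type) (Y : lmodType R) (f : nat -> X -> Y)
    (C : set Y) x j (i : comb_index j) :
  convex_set C -> (forall k, C (f k x)) -> C (comb f i x).
Proof.
move=> cC Cf; elim: j i => [|j IH] i //=; have [? ?] := unit_rat_itv R i.2.
exact: convex_set_onem.
Qed.

Lemma Baire_comb (R : realType) (X : topologicalType) (Y : tvsType R)
    (f : nat -> X -> Y) b j (i : comb_index j) :
  (forall k, Baire_class b (f k)) -> Baire_class b (comb f i).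
Proof.
move=> bf; elim: j i => [|j IH] i //=.
have c1 : continuous (fun p : Y * Y => p.1) by move=> p; exact: cvg_fst.
have c2 : continuous (fun p : Y * Y => p.2) by move=> p; exact: cvg_snd.
apply: (@Baire_comp2 _ _ _ _ _ _ _
  (fun p : Y * Y => unit_rat R i.2 *: p.1 + (1 - unit_rat R i.2) *: p.2)) => //.
by apply: continuous_addr; apply: continuous_scaler => // p; exact: cvg_cst.
Qed.

Definition tube (R : realType) (X : Type) (Y : tvsType R) (f : nat -> X -> Y)
    (V : set Y) : set (X * Y) :=
  \bigcup_(s in [set: {j : nat & comb_index j}])
    [set p | V (p.2 - comb f (tagged s) p.1)].

Lemma Sigma_tube (R : realType) (X : topologicalType) (Y : tvsType R)
    (f : nat -> X -> Y) b (V : set Y) :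
  dyadic X -> dyadic Y -> open V -> (forall k, Baire_class b (f k)) ->
  Sigma_class (OS b) (tube f V).
Proof.
move=> dX dY oV bf; apply: Sigma_countable_bigcup; first exact: dyadic_prod.
  by apply/ole_S/olt_S/ole_Z.
move=> s _; have c1 : continuous (fun p : X * Y => p.1) by move=> p; exact: cvg_fst.
have c2 : continuous (fun p : X * Y => p.2) by move=> p; exact: cvg_snd.
apply: (@Baire_preimage_open _ _ b (fun p : X * Y => p.2 - comb f (tagged s) p.1)) => //.
  exact: dyadic_prod.
apply: (@Baire_comp2 _ _ _ _ _ _ _ _ (@sub_continuous Y)).
  exact: continuous_Baire.
exact: (@Baire_precomp _ _ _ _ _ _ c1 (Baire_comb _ bf)).
Qed.

Lemma convex_tube (R : realType) (X : Type) (Y : tvsType R) (f : nat -> X -> Y)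
    (V : set Y) x :
  open V -> convex_set (V : set Y) -> convex_set (section (tube f V) x : set Y).
Proof.
move=> oV cV y z l /set_mem[[j p] _ /= Vy] /set_mem[[k q] _ /= Vz]; apply/mem_set.
have [p' ep] := comb_lift f k p; have [q' eq] := comb_lift f j q.
move: q' eq; rewrite addnC => q' eq; rewrite -ep in Vy; rewrite -eq in Vz.
have t0 : 0 <= l%:num :> R by exact: ge0.
have t1 : l%:num <= 1 :> R by exact: le1.
set t : R := l%:num in t0 t1.
set u := comb f p' x in Vy; set v := comb f q' x in Vz.
pose w : Y := t *: y + (1 - t) *: z.
have [||r Vr] := @unit_rat_dense R Y
    (fun s : R^o => w - (s *: u + (1 - s) *: v)) V t _ oV t0 t1.
- have cid : continuous (fun s : R^o => s) by move=> s; exact: cvg_id.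
  have ccst (T : topologicalType) (c : T) : continuous (fun _ : R^o => c).
    by move=> s; exact: cvg_cst.
  apply: continuous_subr; first exact: (ccst Y w).
  apply: continuous_addr; apply: continuous_scaler => //; try exact: (ccst Y).
  by apply: (@continuous_subr R^o R R^o (fun=> 1) id) => //; exact: (ccst R^o).
- have -> : w - (t *: u + (1 - t) *: v) = t *: (y - u) + (1 - t) *: (z - v).
    by rewrite /w !scalerBr opprD addrACA.
  exact: convex_set_onem.
by exists (Tagged comb_index ((p', q', r) : comb_index (k + j).+1)).
Qed.

Lemma projection_tube (R : realType) (X : topologicalType) (Y : tvsType R)
    (f : nat -> X -> Y) b (U V : set Y) :
  dyadic X -> dyadic Y -> open V -> (forall k, Baire_class b (f k)) ->
  Sigma_class (OS b) (fst @` ((setT `*` U) `&` tube f V)).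
Proof.
move=> dX dY oV bf.
rewrite (_ : _ @` _ = \bigcup_(s in [set: {j : nat & comb_index j}])
    (comb f (tagged s) @^-1` \bigcup_(y in U) [set z | V (y - z)])).
  apply: Sigma_countable_bigcup => // [|s _]; first by apply/ole_S/olt_S/ole_Z.
  apply: Baire_preimage_open => //; first exact: Baire_comb.
  apply: bigcup_open => y _; apply: open_comp => // z _.
  by apply: (@continuous_subr Y R Y (fun=> y) id) => {}z; [exact: cvg_cst|exact: cvg_id].
apply/seteqP; split => x.
- by move=> [[x' y] /= [[_ Uy] [s _ /= Vs]] <-]; exists s => //; exists y.
- by move=> [s _ [y Uy Vs]]; exists (x, y) => //; split => //; exists s.
Qed.

Lemma tube_sub (R : realType) (X : Type) (Y : tvsType R) (f : nat -> X -> Y)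
    (s : nat -> nat) (V W : set Y) :
  V `<=` W -> tube (fun k => f (s k)) V `<=` tube f W.
Proof.
move=> VW p [[j i] _ /= Vp]; have [i' ei] := comb_reindex f s i.
by exists (Tagged comb_index i') => //=; rewrite ei; exact: VW.
Qed.

Lemma frechet_convex_base (R : realType) (Y : tvsType R) (d : Y -> Y -> R) :
  frechet_metric d -> exists V : nat -> set Y, forall n,
    [/\ open (V n), V n 0, convex_set (V n : set Y), V n.+1 `<=` V n &
        forall z, V n z -> d z 0 < 2^-1 ^+ n].
Proof.
move=> dF; have [_ [ds _]] := dF.
have [W WP] := choice (fun n => convex_nbhs (frechet_nbhs_ball 0 dF (half_exp_gt0 R n))).
pose V := fix V n := if n is m.+1 then V m `&` W n else W 0%N.
have VW n : V n `<=` W n by case: n => [|n] // z [].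
exists V => n; split.
- elim: n => [|n IH] /=; first by have [] := WP 0%N.
  by apply: openI => //; have [] := WP n.+1.
- elim: n => [|n IH] /=; first by have [] := WP 0%N.
  by split => //; have [] := WP n.+1.
- elim: n => [|n IH] /=; first by have [] := WP 0%N.
  move=> y z l /set_mem[Vy Wy] /set_mem[Vz Wz]; apply/mem_set; split.
    by apply/set_mem/IH; exact/mem_set.
  by have [_ _ cW _] := WP n.+1; apply/set_mem/cW; exact/mem_set.
- by move=> z [].
- by move=> z /VW; have [_ _ _ WB] := WP n => /WB /=; rewrite ds.
Qed.

Lemma diam_cvg0 (R : realType) (Y : Type) (d : Y -> Y -> R) (A : nat -> set Y) :
  (forall y z, 0 <= d y z) -> (forall n, A n !=set0) ->
  (forall e, 0 < e -> exists N, forall n, (N <= n)%N ->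
     forall y z, A n y -> A n z -> d y z < e) <->
  (fun n => diam d (A n)) @ \oo --> 0%E.
Proof.
move=> dge0 A0.
have diam_ge0 n : (0 <= diam d (A n))%E.
  have [y Ay] := A0 n; apply: (@le_trans _ _ (d y y)%:E); first by rewrite lee_fin.
  by apply: ereal_sup_ubound; exists y, y.
have diam_le e n : (forall y z, A n y -> A n z -> d y z < e) -> (diam d (A n) <= e%:E)%E.
  move=> Ae; apply: ub_ereal_sup => _ [y [z [Ay Az ->]]].
  by rewrite lee_fin ltW// Ae.
split=> [small|/fine_cvgP[[N _ Nfin] lim] e e0].
- apply/fine_cvgP; split.
  + have [N hN] := small 1 ltr01; exists N => //= n /hN/diam_le le1.
    rewrite fin_numE; apply/andP.
    by split; apply/eqP => h; move: le1 (diam_ge0 n); rewrite h.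
  + apply/cvgrPdist_le => e e0; have [N hN] := small e e0.
    exists N => //= n /hN/diam_le le1; rewrite sub0r normrN ger0_norm ?fine_ge0//.
    rewrite -lee_fin fineK// fin_numE; apply/andP.
    by split; apply/eqP => h; move: le1 (diam_ge0 n); rewrite h.
- have [M _ hM] := cvgr_lt 0 lim e e0; exists (maxn N M) => n.
  rewrite geq_max => /andP[/Nfin /= fn /hM /= lt_e] y z Ay Az.
  apply: le_lt_trans lt_e; rewrite -lee_fin fineK//.
  by apply: ereal_sup_ubound; exists y, z.
Qed.

Lemma tube_near (R : realType) (X : Type) (Y : tvsType R) (d : Y -> Y -> R)
    (fs : nat -> X -> Y) (f : X -> Y) (V : nat -> set Y) x e :
  frechet_metric d -> (fun n => fs n x) @ \oo --> f x ->
  (forall n z, V n z -> d z 0 < 2^-1 ^+ n) -> 0 < e ->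
  exists N, forall n, (N <= n)%N -> forall y,
    section (tube (fun k => fs (n + k)%N) (V n)) x y -> d (f x) y < e.
Proof.
move=> dF lf Vd e0; have [_ [ds [dt _]]] := dF.
have e20 : 0 < e / 2 by rewrite divr_gt0.
have [W [oW Wf cW We]] := convex_nbhs (frechet_nbhs_ball (f x) dF e20).
have [N _ NW] := lf W (open_nbhs_nbhs (conj oW Wf)).
have [M Me] := half_exp_lt e20; exists (maxn N M) => n.
rewrite geq_max => /andP[Nn Mn] y [[j i] _ /= Vy].
set h := comb _ i x in Vy.
have /We /= fh : W h.
  by apply: comb_convex => // k; apply: NW => /=; exact: leq_trans (leq_addr k n).
have yh : d h y < 2^-1 ^+ n by rewrite ds (frechet_subr _ _ dF); exact: Vd.
have nM : 2^-1 ^+ n <= 2^-1 ^+ M :> R.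
  by rewrite ler_wiXn2l// ?invr_ge0// invf_le1// ler1n.
have := dt (f x) h y; lra.
Qed.

Lemma Baire_strips (R : realType) (X : pseudoMetricType R) (Y : tvsType R)
    (d : Y -> Y -> R) a b (f : X -> Y) :
  frechet_metric d -> oeq a (OS b) -> Baire_class a f ->
  exists G : nat -> set (X * Y),
    (forall n, strip a (G n)) /\
    (forall n, G n.+1 `<=` G n) /\
    \bigcap_n G n = graph f /\
    (forall x, (fun n => diam d (section (G n) x)) @ \oo --> 0%E) /\
    (forall n (U : set Y), open U ->
       Sigma_class a (fst @` ((setT `*` U) `&` G n))).
Proof.
move=> dF [ab ba] hf; have [d0 [ds [dt [_ [nd _]]]]] := dF.
have dX := dyadic_pseudometric X; have dY := frechet_dyadic dF.
inversion hf as [? ? [a0 _] _|? ? ai fs _ aia bfs lf]; subst.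
  by have := ole_S_inv (ole_trans ba a0) => /olt_Z_inv.
have {}bfs k : Baire_class b (fs k).
  by apply: Baire_le (bfs k); apply/olt_S_inv; exact: olt_le_trans (aia k) ab.
have [V VP] := frechet_convex_base dF.
have oV n : open (V n) by have [] := VP n.
have Vd n z : V n z -> d z 0 < 2^-1 ^+ n by have [_ _ _ _] := VP n; apply.
pose G n := tube (fun k => fs (n + k)%N) (V n).
have near x e e0 := @tube_near R X Y d fs f V x e dF (lf x) Vd e0.
have fG n x : section (G n) x (f x).
  have : nbhs (f x) [set z | V n (f x - z)].
    apply: (@continuous_subr Y R Y (fun=> f x) id) => //.
    - by move=> z; exact: cvg_cst.
    - by move=> z; exact: cvg_id.
    - by rewrite /= subrr; apply: open_nbhs_nbhs; split => //; have [] := VP n.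
  move=> /(lf x)[N _ NV]; exists (Tagged comb_index (N : comb_index 0)) => //=.
  by apply: NV => /=; exact: leq_addl.
exists G; split; [|split; [|split; [|split]]].
- move=> n; split.
    by apply: Sigma_le ba _; [exact: dyadic_prod|exact: Sigma_tube].
  by move=> x; apply: convex_tube => //; have [] := VP n.
- move=> n; have [_ _ _ VS _] := VP n.
  have := @tube_sub R X Y (fun k => fs (n + k)%N) S _ _ VS.
  suff -> : (fun k => fs (n + k.+1)%N) = (fun k => fs (n.+1 + k)%N) by [].
  by apply/funext => k; rewrite addSnnS.
- apply/seteqP; split=> -[x y] /=; last first.
    by move=> yf n _; rewrite (yf : y = f x); exact: fG.
  move=> Gy; apply/esym/(d0 (f x) y).1; apply/eqP.
  rewrite eq_le (frechet_ge0 _ _ dF) andbT.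
  apply/ler_addgt0Pl => e e0; have [N hN] := near x e e0.
  by rewrite addr0 ltW// (hN N)//; exact: Gy.
- move=> x; apply/diam_cvg0 => [y z|n|e e0]; first exact: frechet_ge0.
    by exists (f x).
  have [|N hN] := near x (e / 2); first by rewrite divr_gt0.
  exists N => n Nn y z /(hN n Nn) fy /(hN n Nn) fz.
  by have := dt y (f x) z; rewrite (ds y (f x)); lra.
- move=> n U oU; apply: (Sigma_le dX ba).
  exact: (@projection_tube R X Y (fun k => fs (n + k)%N)).
Qed.

Lemma strips_preimage_open (R : realType) (X : topologicalType) (Y : tvsType R)
    (d : Y -> Y -> R) a (f : X -> Y) (G : nat -> set (X * Y)) (U : set Y) :
  dyadic X -> frechet_metric d -> ole Defs.one a ->
  \bigcap_n G n = graph f ->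
  (forall x, (fun n => diam d (section (G n) x)) @ \oo --> 0%E) ->
  (forall n (U : set Y), open U ->
     Sigma_class a (fst @` ((setT `*` U) `&` G n))) ->
  open U -> Sigma_class (OS a) (f @^-1` U).
Proof.
move=> dX dF a1 Gf Gd Gp oU; have [_ [_ [_ [_ [nd _]]]]] := dF.
have fG n x : section (G n) x (f x).
  have : (\bigcap_n G n) (x, f x) by rewrite Gf.
  exact.
have [F [cF _ FU UF]] := dyadic_open (frechet_dyadic dF) oU.
rewrite (_ : _ @^-1` _ = \bigcup_(k in [set: nat * nat])
    ~` (fst @` ((setT `*` ~` F k.2) `&` G k.1))).
  apply: Sigma_countable_bigcup => // [|[n m] _ /=].
    by apply/ole_S/olt_S/ole_Z.
  by apply: Sigma_compl (oltS a) _; apply: Gp; exact: closed_openC.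
apply/seteqP; split => x /=.
- move=> /UF[m /nd[e e0 eF]].
  have [N hN] := (diam_cvg0 (fun y z => frechet_ge0 y z dF)
    (fun n => ex_intro _ (f x) (fG n x))).2 (Gd x) e e0.
  exists (N, m) => //= -[[x' y] /= [[_ nFy] Gy] xx']; apply/nFy/eF => /=.
  by rewrite xx' in Gy; exact: hN (leqnn N) _ _ (fG N x) Gy.
- move=> [[n m] _ /= nP]; apply: (FU m); apply: contrapT => nF; apply: nP.
  by exists (x, f x) => //; split => //; exact: fG.
Qed.

Theorem theorem1p7 (R : realType) (X : pseudoMetricType R) (Y : tvsType R)
  (d : Y -> Y -> R) (a : cord) (f : X -> Y) :
  suslin_space R X ->
  frechet_metric d -> separable_space Y ->
  successor_ord a ->
  (Baire_class a f <->
   exists G : nat -> set (X * Y),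
     (forall n, strip a (G n)) /\
     (forall n, G n.+1 `<=` G n) /\
     \bigcap_n G n = graph f /\
     (forall x, (fun n => diam d (section (G n) x)) @ \oo --> 0%E) /\
     (forall n (U : set Y), open U ->
        Sigma_class a (fst @` ((setT `*` U) `&` G n)))).
Proof.
move=> _ dF sY [b ab]; split; first exact: Baire_strips dF ab.
move=> [G [_ [_ [Gf [Gd Gp]]]]].
have a1 : ole Defs.one a by apply: (ole_trans _ ab.2); apply/ole_S/olt_S/ole_Z.
apply: (Baire_of_preimage_open dF sY a1) => U.
exact: strips_preimage_open (dyadic_pseudometric X) dF a1 Gf Gd Gp.
Qed.
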